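(* Consider a face $F$ of $K^k$ and a point $(\bar x_0;\bar x)\in\mathrm{ri}(F)$. If the column $R^k_{:,j}$ belongs to $F$, then the rational expression for $\mu^k_j$ produced by the DD algorithm (defined in the context), evaluated at $(\bar x_0;\bar x)$, is strictly positive.
   Context: $\mathrm{ri}$ denotes relative interior. DD algorithm. Input $\bar A\in\mathbb R^{m\times(n+1)}$ with rows $\bar A_{1,:},\dots,\bar A_{m,:}$. Coordinates of $\mathbb R^{n+1}$ are indexed $0,\dots,n$; points are written $(x_0;x)$; $e_0,\dots,e_n$ are the unit vectors. Let $K^k=\{(x_0;x)\mid x_0\ge0,\ \bar A_{i,:}(x_0;x)\ge0,\ i=1,\dots,k\}$. The algorithm produces matrices $R^k$ ($p_k$ columns) and $L^k$ ($q_k$ columns) with $n+1$ rows, and vectors of functions $\mu^k$ (length $p_k$) and $\theta^k$ (length $q_k$) of $(x_0;x)$. Initialization: $L^0=(e_1,\dots,e_n)$, $\theta^0=x$, $R^0=(e_0)$, $\mu^0=(x_0)$. Iteration $k=1,\dots,m$: write $L,\theta,R,\mu,p,q$ for $L^{k-1},\theta^{k-1},R^{k-1},\mu^{k-1},p_{k-1},q_{k-1}$, and set $\alpha=\bar A_{k,:}L$, $\beta=\bar A_{k,:}R$. Case 1 ($q>0$ and $\alpha\ne0$): let $\xi=\min\{i\mid\alpha_i\neq0\}$; if $\alpha_\xi<0$ replace (in place) $L_{:,\xi},\theta_\xi,\alpha_\xi$ by their negatives. Set $\mu^k=\bigl(\theta_\xi+\sum_{j=\xi+1}^{q}\alpha_j\theta_j/\alpha_\xi+\sum_{j=1}^{p}\beta_j\mu_j/\alpha_\xi,\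 (\mu_j/\alpha_\xi)_{j=1}^{p}\bigr)$, $\theta^k=\bigl((\theta_j)_{j<\xi},(\theta_j/\alpha_\xi)_{j>\xi}\bigr)$, $R^k=\bigl(L_{:,\xi},(\alpha_\xi R_{:,j}-\beta_jL_{:,\xi})_{j=1}^{p}\bigr)$, $L^k=\bigl((L_{:,j})_{j<\xi},(\alpha_\xi L_{:,j}-\alpha_jL_{:,\xi})_{j>\xi}\bigr)$. Case 2 (otherwise): let $N^-,N^0,N^+$ be the sets of $i$ with $\beta_i<0$, $=0$, $>0$, and $N_{\rm tot}=\sum_{i\in N^+}\mu_i\beta_i$. Set $\mu^k=\bigl(\mu_{N^0},(\mu_i+\sum_{j\in N^-}\mu_j\mu_i\beta_j/N_{\rm tot})_{i\in N^+},(\mu_j\mu_i/N_{\rm tot})_{i\in N^+,j\in N^-}\bigr)$, $R^k=\bigl(R_{:,N^0},R_{:,N^+},(\beta_iR_{:,j}-\beta_jR_{:,i})_{i\in N^+,j\in N^-}\bigr)$, $\theta^k=\theta$, $L^k=L$. Expressions are evaluated at a point by following these formulas; where some $N_{\rm tot}$ vanishes at the point, quotients with that $N_{\rm tot}$ as denominator are given the value $0$. *)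

(* Defs.v *)
From HB Require Import structures.
From mathcomp Require Import all_boot all_order all_algebra.
From mathcomp Require Import all_classical all_reals all_analysis.

Set Implicit Arguments.
Unset Strict Implicit.
Unset Printing Implicit Defensive.

Import Order.TTheory GRing.Theory Num.Theory.
Import numFieldNormedType.Exports.

Local Open Scope classical_set_scope.
Local Open Scope ring_scope.

Section ConvexGeometry.
Variables (R : realType) (n : nat).
Implicit Types F K : set 'cV[R]_n.

Definition affine_hull F : set 'cV[R]_n :=
  [set x | exists (s : nat) (c : 'I_s -> R) (a : 'I_s -> 'cV[R]_n),
     [/\ forall i, F (a i), \sum_i c i = 1 & x = \sum_i c i *: a i]].

(* Interior relative to the affine hull, for the usual topology of R^n. *)
Definition relint F : set 'cV[R]_n :=
  [set x | F x /\ \forall y \near x, affine_hull F y -> F y].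

(* A face is a convex subset containing both endpoints of every segment of K
   that it meets at a relative interior point. *)
Definition is_face F K : Prop :=
  [/\ F `<=` K,
      convex_set (F : set (convex_lmodType 'cV[R]_n)) &
      forall (y z : 'cV[R]_n) (t : R), K y -> K z -> 0 < t < 1 ->
        F (t *: y + (1 - t) *: z) -> F y /\ F z].

End ConvexGeometry.

Section DoubleDescription.
Variables (R : realType) (n : nat).

(* The matrices R^k and L^k are stored as the sequences of their columns;
   indices are 0-based. *)
Record dd_state := DDState {
  dd_L : seq 'cV[R]_n.+1;
  dd_theta : seq ('cV[R]_n.+1 -> R);
  dd_R : seq 'cV[R]_n.+1;
  dd_mu : seq ('cV[R]_n.+1 -> R) }.

Definition dd_init : dd_state :=
  DDState [seq delta_mx (lift ord0 i) 0 | i <- enum 'I_n]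
          [seq (fun x : 'cV[R]_n.+1 => x (lift ord0 i) 0) | i <- enum 'I_n]
          [:: delta_mx ord0 0]
          [:: fun x : 'cV[R]_n.+1 => x ord0 0].

(* One iteration, for the constraint 0 <= a *m x. Division by zero yields zero
   in a field, which is the convention adopted when N_tot vanishes. *)
Definition dd_step (s : dd_state) (a : 'rV[R]_n.+1) : dd_state :=
  let L i := nth 0 (dd_L s) i in
  let theta i := nth (fun=> 0) (dd_theta s) i in
  let r i := nth 0 (dd_R s) i in
  let mu i := nth (fun=> 0) (dd_mu s) i in
  let p := size (dd_R s) in
  let q := size (dd_L s) in
  let alpha i : R := (a *m L i) 0 0 in
  let beta i : R := (a *m r i) 0 0 in
  if has (fun i => alpha i != 0) (iota 0 q) then
    let xi := find (fun i => alpha i != 0) (iota 0 q) in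
    let neg := alpha xi < 0 in
    let Lxi := if neg then - L xi else L xi in
    let theta_xi (x : 'cV[R]_n.+1) := if neg then - theta xi x else theta xi x in
    let alpha_xi := if neg then - alpha xi else alpha xi in
    let before := iota 0 xi in
    let after := iota xi.+1 (q - xi.+1) in
    DDState
      ([seq L j | j <- before]
         ++ [seq alpha_xi *: L j - alpha j *: Lxi | j <- after])
      ([seq theta j | j <- before]
         ++ [seq (fun x => theta j x / alpha_xi) | j <- after])
      (Lxi :: [seq alpha_xi *: r j - beta j *: Lxi | j <- iota 0 p])
      ((fun x => theta_xi x
                 + \sum_(j <- after) alpha j * theta j x / alpha_xi
                 + \sum_(j <- iota 0 p) beta j * mu j x / alpha_xi)
         :: [seq (fun x => mu j x / alpha_xi) | j <- iota 0 p])
  else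
    let Nneg := [seq i <- iota 0 p | beta i < 0] in
    let Nzero := [seq i <- iota 0 p | beta i == 0] in
    let Npos := [seq i <- iota 0 p | 0 < beta i] in
    let Ntot x := \sum_(i <- Npos) mu i x * beta i in
    DDState
      (dd_L s)
      (dd_theta s)
      ([seq r i | i <- Nzero]
         ++ [seq r i | i <- Npos]
         ++ [seq beta i *: r j - beta j *: r i | i <- Npos, j <- Nneg])
      ([seq mu i | i <- Nzero]
         ++ [seq (fun x => mu i x
                   + \sum_(j <- Nneg) mu j x * mu i x * beta j / Ntot x)
            | i <- Npos]
         ++ [seq (fun x => mu j x * mu i x / Ntot x)
            | i <- Npos, j <- Nneg]).

Variable m : nat.
Implicit Type A : 'M[R]_(m, n.+1).

Definition dd A (k : nat) : dd_state :=
  foldl dd_step dd_init (take k [seq row i A | i <- enum 'I_m]).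

Definition dd_cone A (k : nat) : set 'cV[R]_n.+1 :=
  [set x : 'cV[R]_n.+1 | 0 <= x ord0 0 /\
           forall i : 'I_m, (i < k)%N -> 0 <= (row i A *m x) 0 0].

End DoubleDescription.

(* Main.v *)
Require Import Defs.
From mathcomp Require Import all_boot all_order all_algebra.
From mathcomp Require Import all_classical all_reals all_analysis.
From mathcomp Require Import ring.

Local Open Scope classical_set_scope.
Local Open Scope ring_scope.

Set Implicit Arguments.
Unset Strict Implicit.
Unset Printing Implicit Defensive.

Import Order.TTheory GRing.Theory Num.Theory.
Import numFieldNormedType.Exports.

(** For x in K^k, the value of mu^k_j at x is the coefficient of the column
    R^k_j in a decomposition of x into nonnegative multiples of the columns of
    R^k plus a combination of the columns of L^k, which lie in the lineality
    space.
    The coefficient is shown to be positive by induction on k for every pair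
    (x, R_j) such that x - e R_j stays in the cone K^k for some e > 0
    (field mu_gt0 of dd_invariant).  This suffices: a relative interior point
    x of F can be pushed slightly away from R_j without leaving F
    (relint_extend), and rescaling (1 + e) x - e R_j gives such an e.

    In the inductive step (dd_invariant_step), with a the new row:
    - in a pivot step, the new first coefficient equals a x / alpha_xi, and
      a x >= e alpha_xi > 0 because x - e L_xi satisfies the new inequality;
      the other new rays differ from positive multiples of the old ones by
      lineality vectors, which can be cancelled inside the old cone;
    - in a combination step, a x is the sum of the beta_i mu_i(x), so the
      coefficient of a ray i with beta_i > 0 becomes mu_i(x) (a x) / N_tot(x),
      which is positive since mu_i(x) > 0 by induction and a x >= e beta_i; if
      x minus a small multiple of beta_i R_j - beta_j R_i lies in the cone,
      adding back either of its two parts shows that mu_i(x) and mu_j(x) are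
      both positive, hence so is N_tot(x).
    That the decomposition and the nonnegativity of the coefficients persist
    on the new cone is proved alongside; where N_tot(x) = 0, the inequality
    0 <= a x makes all coefficients of rays with beta_j < 0 vanish. *)

(** * Lists and sums *)

Lemma zip_nth_iota (T U : Type) (x0 : T) (y0 : U) (s : seq T) (t : seq U) :
  size s = size t ->
  zip s t = [seq (nth x0 s i, nth y0 t i) | i <- iota 0 (size s)].
Proof.
move=> st; rewrite -zip_map -{1}(mkseq_nth x0 s) -{1}(mkseq_nth y0 t) /mkseq.
by rewrite st.
Qed.

Lemma zip_allpairs (I J S T : Type) (f : I -> J -> S) (g : I -> J -> T) r t :
  zip [seq f i j | i <- r, j <- t] [seq g i j | i <- r, j <- t] =
  [seq (f i j, g i j) | i <- r, j <- t].
Proof. by elim: r => //= i r <-; rewrite zip_cat ?size_map// zip_map. Qed.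

Lemma sum_sign (R : realDomainType) (V : zmodType) (I : Type) (b : I -> R)
    (G : I -> V) (l : seq I) :
  \sum_(i <- l) G i = \sum_(i <- l | b i == 0) G i
    + \sum_(i <- l | 0 < b i) G i + \sum_(i <- l | b i < 0) G i.
Proof.
elim: l => [|i l IH]; first by rewrite !big_nil !addr0.
rewrite !big_cons IH; case: ltrgt0P => _; rewrite !addrA //.
  by rewrite (addrC (G i)).
by rewrite -(addrA (G i)) (addrC (G i)).
Qed.

Lemma sumr_seq_eq0 (R : numDomainType) (I : eqType) (t : seq I) (G : I -> R) :
  (forall i, i \in t -> 0 <= G i) -> \sum_(i <- t) G i = 0 ->
  forall i, i \in t -> G i = 0.
Proof.
move=> G0; rewrite big_seq => /eqP; rewrite psumr_eq0 // => /allP H i it.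
by move: (H i it); rewrite it => /eqP.
Qed.

(** * Relative interiors and cones *)

(** Segments ending at a relative interior point can be prolonged beyond it. *)
Lemma relint_extend (R : realType) (n : nat) (F : set 'cV[R]_n.+1) x y :
  relint F x -> F y -> exists2 e : R, 0 < e & F (x + e *: (x - y)).
Proof.
move=> [Fx nearF] Fy.
have cvx : (x + e *: (x - y)) @[e --> (0 : R)] --> x.
  suff : (x + e *: (x - y)) @[e --> (0 : R)] --> x + 0 *: (x - y).
    by rewrite scale0r addr0.
  apply: cvgD; first exact: cvg_cst.
  exact: (@scalel_continuous R 'cV[R]_n.+1 (x - y) 0).
have near0 := cvx _ nearF.
have nearr : \forall e \near (0 : R)^'+,
    affine_hull F (x + e *: (x - y)) -> F (x + e *: (x - y)).
  exact: (cvg_within (fun e : R => 0 < e) near0).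
have [e [He e0]] : exists e : R,
    (affine_hull F (x + e *: (x - y)) -> F (x + e *: (x - y))) /\ 0 < e.
  near (0 : R)^'+ => e; exists e; split; first by near: e.
  by near: e; exact: nbhs_right_gt.
exists e => //; apply: He.
exists 2%N, (fun i : 'I_2 => if i == 0 then 1 + e else - e),
  (fun i : 'I_2 => if i == 0 then x else y).
split => [i||]; first by case: ifP.
  by rewrite big_ord_recl big_ord1 /= addrK.
rewrite big_ord_recl big_ord1 /= scalerDl scale1r scaleNr scalerBr.
by rewrite addrA.
Unshelve. all: by end_near.
Qed.

Section DDInvariant.
Variables (R : realType) (n : nat).
Implicit Types (a : 'rV[R]_n.+1) (x y : 'cV[R]_n.+1).

(** The value at x of the linear form with coefficient row a. *)
Definition pairing a x : R := (a *m x) 0 0.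

Lemma pairingD a x y : pairing a (x + y) = pairing a x + pairing a y.
Proof. by rewrite /pairing mulmxDr mxE. Qed.

Lemma pairingZ a c x : pairing a (c *: x) = c * pairing a x.
Proof. by rewrite /pairing -scalemxAr mxE. Qed.

Lemma pairingN a x : pairing a (- x) = - pairing a x.
Proof. by rewrite /pairing mulmxN mxE. Qed.

Lemma pairingB a x y : pairing a (x - y) = pairing a x - pairing a y.
Proof. by rewrite pairingD pairingN. Qed.

Lemma pairing_sum a I (r : seq I) (f : I -> 'cV[R]_n.+1) :
  pairing a (\sum_(i <- r) f i) = \sum_(i <- r) pairing a (f i).
Proof. by rewrite /pairing mulmx_sumr summxE. Qed.

(** The half-space of the points satisfying the inequality 0 <= a x. *)
Definition halfspace a : set 'cV[R]_n.+1 := [set x | 0 <= pairing a x].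

(** Convex cones; K may be empty, so 0 is not required to belong to K. *)
Definition is_cone (K : set 'cV[R]_n.+1) : Prop :=
  (forall x y, K x -> K y -> K (x + y)) /\
  (forall c x, 0 <= c -> K x -> K (c *: x)).

(** * The invariant of the algorithm *)

(** The columns of the matrix R paired with their coefficient functions, and
    likewise for the matrix L. *)
Definition rays (s : dd_state R n) := zip (dd_R s) (dd_mu s).
Definition lines (s : dd_state R n) := zip (dd_L s) (dd_theta s).

(** The state s describes the cone K: columns of R lie in K, columns of L in
    its lineality space, and mu and theta decompose every point of K with mu
    nonnegative.  Field mu_gt0 is the positivity statement: x - e *: g.1 in K
    for some e > 0 says that g.1 lies in the smallest face of K containing
    x. *)
Record dd_invariant (K : set 'cV[R]_n.+1) (s : dd_state R n) : Prop := {
  size_rays : size (dd_R s) = size (dd_mu s);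
  size_lines : size (dd_L s) = size (dd_theta s);
  rays_in : forall g, g \in rays s -> K g.1;
  lines_in : forall g, g \in lines s -> K g.1 /\ K (- g.1);
  mu_ge0 : forall g x, g \in rays s -> K x -> 0 <= g.2 x;
  mu_gt0 : forall g x e, g \in rays s -> K x -> 0 < e -> K (x - e *: g.1) ->
    0 < g.2 x;
  decomposition : forall x, K x ->
    x = \sum_(g <- rays s) g.2 x *: g.1 + \sum_(g <- lines s) g.2 x *: g.1 }.

Lemma dd_invariant_init :
  dd_invariant [set x | 0 <= x ord0 0] (dd_init R n).
Proof.
split => //.
- by rewrite /= !size_map.
- by move=> g; rewrite inE => /eqP -> /=; rewrite mxE !eqxx ler01.
- move=> g; rewrite /lines /= zip_map => /mapP[i _ ->] /=.
  by rewrite !mxE /= oppr0 lexx.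
- by move=> g x; rewrite inE => /eqP ->.
- move=> g x e; rewrite inE => /eqP -> /= _ e0.
  by rewrite !mxE !eqxx mulr1 subr_ge0; apply: lt_le_trans.
- move=> x _; rewrite /rays /lines /= big_seq1 zip_map big_map big_enum /=.
  apply/colP => i; rewrite !mxE summxE eqxx andbT.
  case: (unliftP ord0 i) => [l ->|->] /=.
    rewrite mulr0 add0r (bigD1 l)//= !mxE !eqxx mulr1 big1 ?addr0// => l' ll'.
    by rewrite !mxE andbT (inj_eq lift_inj) eq_sym (negPf ll') mulr0.
  rewrite mulr1 big1 ?addr0// => l _.
  by rewrite !mxE andbT -(negbK (_ == _)) neq_lift mulr0.
Qed.

(** The two halves of the proof are the pivot step, where some alpha_i is
    nonzero, and the combination step. *)
Lemma dd_invariant_step K s a : is_cone K -> dd_invariant K s ->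
  dd_invariant (K `&` halfspace a) (dd_step s a).
Proof.
move=> [KD KZ] [sR sL RK LK mge mgt dec].
pose r i := nth 0 (dd_R s) i.
pose mu i := nth (fun=> 0) (dd_mu s) i.
pose L i := nth 0 (dd_L s) i.
pose theta i := nth (fun=> 0) (dd_theta s) i.
set p := size (dd_R s); set q := size (dd_L s).
pose alpha i := pairing a (L i).
pose beta i := pairing a (r i).
have raysE : rays s = [seq (r i, mu i) | i <- iota 0 p] by exact: zip_nth_iota.
have linesE : lines s = [seq (L i, theta i) | i <- iota 0 q].
  exact: zip_nth_iota.
have rK i : i \in iota 0 p -> K (r i).
  by move=> ip; apply: (RK (r i, mu i)); rewrite raysE; apply: map_f.
have mu0 i x : i \in iota 0 p -> K x -> 0 <= mu i x.
  by move=> ip; apply: (mge (r i, mu i)); rewrite raysE; apply: map_f.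
have mu1 i x e : i \in iota 0 p -> K x -> 0 < e -> K (x - e *: r i) ->
    0 < mu i x.
  by move=> ip; apply: (mgt (r i, mu i)); rewrite raysE; apply: map_f.
have LK1 i : i \in iota 0 q -> K (L i) /\ K (- L i).
  by move=> ip; apply: (LK (L i, theta i)); rewrite linesE; apply: map_f.
have LKZ i c : i \in iota 0 q -> K (c *: L i).
  move=> /LK1[K1 K2]; have [c0|c0] := leP 0 c; first exact: KZ.
  by rewrite -[c]opprK scaleNr -scalerN; apply: KZ; rewrite // oppr_ge0 ltW.
have {}dec x : K x -> x = \sum_(i <- iota 0 p) mu i x *: r i
    + \sum_(i <- iota 0 q) theta i x *: L i.
  by move=> /dec; rewrite raysE linesE !big_map.
have aE x : K x -> pairing a x = \sum_(i <- iota 0 p) beta i * mu i x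
    + \sum_(i <- iota 0 q) alpha i * theta i x.
  move=> Kx; rewrite {1}(dec x Kx) pairingD !pairing_sum.
  by congr (_ + _); apply: eq_bigr => i _; rewrite pairingZ mulrC.
rewrite /dd_step -/p -/q; case: ifP => [hasa|noa]; cbv zeta.
- rewrite -[fun i => (_ *m nth 0 (dd_L s) i) _ _ != 0]/(fun i => alpha i != 0)
    in hasa *.
  set xi := find _ _.
  have xiq : (xi < q)%N by rewrite -[q](size_iota 0) -has_find.
  have xiin : xi \in iota 0 q by rewrite mem_iota add0n.
  have axi : alpha xi != 0.
    by have := nth_find 0%N hasa; rewrite -/xi nth_iota // add0n.
  have abefore i : i \in iota 0 xi -> alpha i = 0.
    rewrite mem_iota add0n => /= ixi; apply/eqP; apply/negbFE.
    have := before_find 0%N ixi; rewrite nth_iota ?add0n //.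
    exact: ltn_trans ixi xiq.
  set c := if _ then _ else _; set v := if _ then _ else _.
  pose tv x := if alpha xi < 0 then - theta xi x else theta xi x.
  have cE : c = pairing a v.
    by rewrite /c /v /alpha; case: ifP => //; rewrite pairingN.
  have c0 : 0 < c.
    rewrite /c; case: ifP => ax; first by rewrite oppr_gt0.
    by rewrite lt0r leNgt ax andbT; exact: axi.
  have cN0 := lt0r_neq0 c0.
  (* The optional sign change affects both v and tv, so it cancels in products. *)
  have tvE x : tv x *: v = theta xi x *: L xi.
    by rewrite /tv /v; case: ifP => //; rewrite scalerN scaleNr opprK.
  have ctv x : c * tv x = alpha xi * theta xi x.
    by rewrite /tv /c; case: ifP => //; rewrite mulrNN.
  (* As v and its opposite lie in K, so does the whole line. *)
  have Kv d : K (d *: v).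
    by rewrite /v; case: ifP => _; rewrite ?scalerN -?scaleNr; exact: LKZ.
  set after := iota xi.+1 _.
  have qE : iota 0 q = iota 0 xi ++ xi :: after.
    by rewrite -[in LHS](subnKC (ltnW xiq)) iotaD add0n -subnSK.
  have afterq i : i \in after -> i \in iota 0 q.
    by move=> ia; rewrite qE mem_cat inE ia !orbT.
  have beforeq i : i \in iota 0 xi -> i \in iota 0 q.
    by move=> ia; rewrite qE mem_cat ia.
  (* The coefficient of the new ray v; the next fact simplifies it on K. *)
  pose mu' x := tv x + \sum_(j <- after) alpha j * theta j x / c
                 + \sum_(j <- iota 0 p) beta j * mu j x / c.
  have mu'E x : K x -> mu' x = pairing a x / c.
    move=> Kx.
    have before0 : \sum_(i <- iota 0 xi) alpha i * theta i x = 0.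
      by rewrite big1_seq // => i /andP[_ /abefore ->]; rewrite mul0r.
    rewrite aE // qE big_cat big_cons /= before0 add0r -ctv /mu' -!mulr_suml.
    by field.
  set s' := DDState _ _ _ _.
  have raysE' : rays s' = (v, mu') ::
      [seq (c *: r j - beta j *: v, fun x => mu j x / c) | j <- iota 0 p].
    by rewrite /rays /= zip_map.
  have linesE' : lines s' = [seq (L j, theta j) | j <- iota 0 xi]
      ++ [seq (c *: L j - alpha j *: v, fun x => theta j x / c) | j <- after].
    by rewrite /lines /= zip_cat ?size_map// !zip_map.
  have av := esym cE.
  have aKv d : halfspace a (d *: v) = (0 <= d) :> Prop.
    by rewrite /halfspace /= pairingZ av pmulr_lge0.
  split.
  + by rewrite /= !size_map.
  + by rewrite /= !size_cat !size_map.
  + move=> g; rewrite raysE' inE => /orP[/eqP ->|/mapP[j jp ->]] /=.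
      by rewrite -[v]scale1r; split; rewrite ?aKv ?ler01.
    split; first by rewrite -scaleNr; apply: KD => //; apply/KZ/rK; rewrite ?ltW.
    by rewrite /halfspace /= pairingB !pairingZ av mulrC subrr.
  + move=> g; rewrite linesE' mem_cat => /orP[/mapP[j ja ->]|/mapP[j ja ->]] /=.
      have [K1 K2] := LK1 _ (beforeq _ ja).
      by split; split => //; rewrite /halfspace /= ?pairingN
        [pairing _ _]abefore ?oppr0.
    have aj : pairing a (c *: L j - alpha j *: v) = 0.
      by rewrite pairingB !pairingZ av mulrC subrr.
    rewrite /halfspace /=; split; split; rewrite /= ?pairingN ?aj ?oppr0 //.
      by rewrite -scaleNr; apply: KD => //; apply: LKZ; exact: afterq.
    by rewrite opprB -scaleNr; apply: KD => //; apply: LKZ; exact: afterq.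
  + move=> g x; rewrite raysE' inE => /orP[/eqP ->|/mapP[j jp ->]] [Kx ax] /=.
      by rewrite mu'E // divr_ge0 // ltW.
    by rewrite divr_ge0 ?mu0 // ltW.
  + move=> g x e; rewrite raysE' inE => /orP[/eqP ->|/mapP[j jp ->]] [Kx ax] /=.
      move=> e0 [_]; rewrite /halfspace /= pairingB pairingZ av subr_ge0 => le_ax.
      by rewrite mu'E // divr_gt0 // (lt_le_trans _ le_ax) // mulr_gt0.
    move=> e0 [Kxe _]; rewrite divr_gt0 //; apply: (mu1 j x (e * c)) => //.
      exact: mulr_gt0.
    (* Cancel the component along v, which lies in the lineality space. *)
    have -> : x - (e * c) *: r j =
        x - e *: (c *: r j - beta j *: v) + (- (e * beta j)) *: v.
      by rewrite scalerBr !scalerA opprB scaleNr addrA addrAC addrK.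
    exact: KD.
  + move=> x [Kx _]; rewrite raysE' linesE' big_cons big_cat /= !big_map /=.
    rewrite {1}(dec x Kx) qE big_cat big_cons /=.
    have pivoted (g : nat -> R) (b : nat -> R) (w : nat -> 'cV[R]_n.+1) t :
        \sum_(j <- t) (g j / c) *: (c *: w j - b j *: v) =
        \sum_(j <- t) g j *: w j - (\sum_(j <- t) b j * g j / c) *: v.
      rewrite scaler_suml -sumrB; apply: eq_bigr => j _.
      by rewrite scalerBr !scalerA mulfVK // [_ * b j]mulrC mulrA.
    rewrite !pivoted -tvE /mu' !scalerDl.
    set A1 := \sum_(j <- _) _; set A2 := \sum_(j <- _) _.
    set A3 := \sum_(j <- _) _; set B1 := _ *: v; set B2 := _ *: v.
    by apply/colP => i; rewrite !mxE; ring.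
- have alpha0 i : i \in iota 0 q -> alpha i = 0.
    by move=> iq; apply/eqP/negbNE/(hasPn (negbT noa)).
  set Nz := [seq i <- iota 0 p | _ == 0]; set Np := [seq i <- iota 0 p | 0 < _].
  set Nn := [seq i <- iota 0 p | _ < 0].
  (* S is the negative counterpart of Ntot; on K they add up to a x, see axE. *)
  pose Ntot x := \sum_(i <- Np) mu i x * beta i.
  pose S x := \sum_(j <- Nn) mu j x * beta j.
  pose mu' i x := mu i x + \sum_(j <- Nn) mu j x * mu i x * beta j / Ntot x.
  set s' := DDState _ _ _ _.
  have raysE' : rays s' = [seq (r i, mu i) | i <- Nz]
      ++ [seq (r i, mu' i) | i <- Np]
      ++ [seq (beta i *: r j - beta j *: r i,
               fun x => mu j x * mu i x / Ntot x) | i <- Np, j <- Nn].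
    rewrite /rays /= !zip_cat ?size_map// !zip_map; congr (_ ++ (_ ++ _)).
    exact: zip_allpairs.
  have NzP i : i \in Nz -> i \in iota 0 p /\ beta i = 0.
    by rewrite mem_filter => /andP[/eqP].
  have NpP i : i \in Np -> i \in iota 0 p /\ 0 < beta i.
    by rewrite mem_filter => /andP[].
  have NnP i : i \in Nn -> i \in iota 0 p /\ beta i < 0.
    by rewrite mem_filter => /andP[].
  have splitp (V : zmodType) (G : nat -> V) : \sum_(i <- iota 0 p) G i =
      \sum_(i <- Nz) G i + \sum_(i <- Np) G i + \sum_(i <- Nn) G i.
    by rewrite !big_filter; exact: sum_sign.
  have N0 x : K x -> 0 <= Ntot x.
    move=> Kx; rewrite /Ntot big_seq; apply: sumr_ge0 => i /NpP[ip bi].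
    by rewrite mulr_ge0 ?mu0 // ltW.
  have axE x : K x -> pairing a x = Ntot x + S x.
    move=> Kx; rewrite aE // [X in _ + X]big1_seq ?addr0; last first.
      by move=> i /andP[_ /alpha0 ->]; rewrite mul0r.
    rewrite splitp big1_seq ?add0r; last first.
      by move=> i /andP[_ /NzP[_ ->]]; rewrite mul0r.
    by congr (_ + _); apply: eq_bigr => i _; rewrite mulrC.
  have mu'E i x : mu' i x = mu i x + mu i x * (S x / Ntot x).
    congr (_ + _); rewrite /S mulr_suml mulr_sumr; apply: eq_bigr => j _.
    by rewrite [mu j x * _]mulrC !mulrA.
  have mu'a i x : K x -> Ntot x != 0 ->
      mu' i x = mu i x * (pairing a x / Ntot x).
    by move=> Kx Nx; rewrite mu'E axE //; field.
  have N1 i x : i \in Np -> K x -> 0 < mu i x -> 0 < Ntot x.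
    move=> iN Kx mui; have [ip bi] := NpP _ iN.
    rewrite lt0r N0 // andbT; apply/negP => /eqP Nx.
    have /eqP : mu i x * beta i = 0.
      apply: (sumr_seq_eq0 _ Nx) iN => l /NpP[lp bl].
      by rewrite mulr_ge0 ?mu0 // ltW.
    by rewrite mulf_eq0 !gt_eqF.
  split.
  + by rewrite /= !size_cat !size_map !size_allpairs.
  + by [].
  + move=> g; rewrite raysE' !mem_cat => /or3P[/mapP[i iN ->]|/mapP[i iN ->]|].
    * have [ip bi] := NzP _ iN.
      by split; [exact: rK|rewrite /halfspace /= [pairing _ _]bi].
    * have [ip bi] := NpP _ iN.
      by split; [exact: rK|exact: ltW].
    * move=> /allpairsP[[i j] /= [iN jN ->]] /=.
      have [[ip bi] [jp bj]] := (NpP _ iN, NnP _ jN).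
      split; last by rewrite /halfspace /= pairingB !pairingZ mulrC subrr.
      rewrite -scaleNr; apply: KD; apply: KZ; rewrite ?oppr_ge0 ?ltW //;
        exact: rK.
  + move=> g; rewrite -[lines s']/(lines s) => gl.
    have [K1 K2] := LK _ gl.
    move: gl; rewrite linesE => /mapP[i iq gi].
    by split; split => //; rewrite /halfspace /= gi ?pairingN
      [pairing _ _]alpha0 ?oppr0.
  + move=> g x; rewrite raysE' !mem_cat => gR [Kx ax]; move: gR.
    move=> /or3P[/mapP[i iN ->]|/mapP[i iN ->]|].
    * by apply: mu0 => //; have [] := NzP _ iN.
    * have [ip _] := NpP _ iN.
      (* When Ntot x = 0 the quotients vanish and mu' i x is mu i x. *)
      have [Nx|Nx] := eqVneq (Ntot x) 0.
        by rewrite /= mu'E Nx invr0 !mulr0 addr0 mu0.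
      by rewrite /= mu'a // mulr_ge0 ?mu0 // divr_ge0 ?N0.
    * move=> /allpairsP[[i j] /= [iN jN ->]] /=.
      have [[ip bi] [jp bj]] := (NpP _ iN, NnP _ jN).
      by rewrite divr_ge0 ?N0 // mulr_ge0 ?mu0.
  + move=> g x e; rewrite raysE' !mem_cat => gR [Kx ax] e0; move: gR.
    move=> /or3P[/mapP[i iN ->]|/mapP[i iN ->]|].
    * by move=> [Ke _]; apply: mu1 e0 Ke => //; have [] := NzP _ iN.
    * have [ip bi] := NpP _ iN; move=> /= [Ke ae].
      have mui := mu1 _ _ _ ip Kx e0 Ke.
      have Nx := N1 _ _ iN Kx mui.
      rewrite mu'a ?gt_eqF // mulr_gt0 // divr_gt0 //.
      move: ae; rewrite /halfspace /= pairingB pairingZ subr_ge0.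
      by apply: lt_le_trans; exact: mulr_gt0.
    * move=> /allpairsP[[i j] /= [iN jN ->]] /= [Ke _].
      have [[ip bi] [jp bj]] := (NpP _ iN, NnP _ jN).
      have muj : 0 < mu j x.
        apply: (mu1 j x (e * beta i)) => //; first exact: mulr_gt0.
        (* Both parts of the combined ray lie in K: add one of them back. *)
        have -> : x - (e * beta i) *: r j =
            x - e *: (beta i *: r j - beta j *: r i) + (e * - beta j) *: r i.
          by apply/colP => l; rewrite !mxE; ring.
        by apply: KD => //; apply: KZ (rK _ ip); rewrite mulr_ge0 ?oppr_ge0 ?ltW.
      have mui : 0 < mu i x.
        apply: (mu1 i x (e * - beta j)) => //.
          by rewrite mulr_gt0 // oppr_gt0.
        have -> : x - (e * - beta j) *: r i =
            x - e *: (beta i *: r j - beta j *: r i) + (e * beta i) *: r j.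
          by apply/colP => l; rewrite !mxE; ring.
        by apply: KD => //; apply: KZ (rK _ jp); rewrite mulr_ge0 ?ltW.
      by rewrite divr_gt0 ?mulr_gt0 // (N1 i).
  + move=> x [Kx ax]; rewrite -[lines s']/(lines s) raysE' !big_cat /= !big_map.
    rewrite {1}(dec x Kx) linesE big_map splitp /=; congr (_ + _).
    rewrite -addrA; congr (_ + _).
    rewrite big_allpairs_dep /=.
    pose Q := \sum_(j <- Nn) mu j x *: r j.
    have inner i : \sum_(j <- Nn)
          (mu j x * mu i x / Ntot x) *: (beta i *: r j - beta j *: r i) =
        (mu i x * beta i / Ntot x) *: Q - (mu i x * (S x / Ntot x)) *: r i.
      rewrite /S /Q mulr_suml mulr_sumr scaler_suml scaler_sumr -sumrB.
      apply: eq_bigr => j _; rewrite scalerBr !scalerA.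
      by congr (_ *: _ - _ *: _); ring.
    under [X in _ = _ + X]eq_bigr do rewrite inner.
    under [X in _ = X + _]eq_bigr do rewrite mu'E scalerDl.
    rewrite sumrB big_split /= -scaler_suml -mulr_suml -/(Ntot x) -/Q.
    rewrite addrACA subrr addr0; congr (_ + _).
    have [Nx|Nx] := eqVneq (Ntot x) 0; last by rewrite divff // scale1r.
    rewrite Nx mul0r scale0r /Q big1_seq // => j /andP[_ jN].
    (* Here 0 <= a x = S x, while S x is a sum of nonpositive terms. *)
    have jS : - (mu j x * beta j) = 0.
      apply: (sumr_seq_eq0 (G := fun j => - (mu j x * beta j))) jN.
        move=> l /NnP[lp bl]; rewrite -mulrN mulr_ge0 ?mu0 // oppr_ge0 ltW //.
      apply/eqP; rewrite sumrN oppr_eq0 -/(S x) eq_le; apply/andP; split.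
        rewrite /S big_seq; apply: sumr_le0 => l /NnP[lp bl].
        by rewrite mulr_ge0_le0 ?mu0 // ltW.
      by move: ax; rewrite /halfspace /= axE // Nx add0r.
    have [_ bj] := NnP _ jN.
    move/eqP: jS; rewrite oppr_eq0 mulf_eq0 (lt_eqF bj) orbF => /eqP ->.
    by rewrite scale0r.
Qed.

(** * The cones and states of the algorithm *)

Lemma dd_cone_is_cone m (A : 'M[R]_(m, n.+1)) k : is_cone (dd_cone A k).
Proof.
split=> [x y [x0 Ax] [y0 Ay]|c x c0 [x0 Ax]]; split=> [|i ik].
- by rewrite mxE addr_ge0.
- by rewrite -/(pairing _ _) pairingD addr_ge0 ?Ax ?Ay.
- by rewrite mxE mulr_ge0.
- by rewrite -/(pairing _ _) pairingZ mulr_ge0 ?Ax.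
Qed.

Lemma dd_coneS m (A : 'M[R]_(m, n.+1)) (i : 'I_m) :
  dd_cone A i.+1 = dd_cone A i `&` halfspace (row i A).
Proof.
apply/seteqP; split=> x.
  by move=> [x0 Ax]; split; [split=> // l li; apply/Ax/ltnW|exact: Ax].
move=> [[x0 Ax] xi]; split=> // l; rewrite ltnS leq_eqVlt => /orP[/eqP|/Ax //].
by move=> /val_inj ->.
Qed.

Lemma ddS m (A : 'M[R]_(m, n.+1)) (i : 'I_m) :
  dd A i.+1 = dd_step (dd A i) (row i A).
Proof.
have size_rows : size [seq row l A | l <- enum 'I_m] = m.
  exact: etrans (size_map _ _) (size_enum_ord m).
rewrite /dd (take_nth 0) ?size_rows // foldl_rcons.
by rewrite (nth_map i) ?nth_ord_enum // size_enum_ord.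
Qed.

Lemma dd_invariant_dd m (A : 'M[R]_(m, n.+1)) k : (k <= m)%N ->
  dd_invariant (dd_cone A k) (dd A k).
Proof.
elim: k => [_|k IH km].
  have -> : dd_cone A 0 = [set x | 0 <= x ord0 0].
    by apply/seteqP; split=> x => [[]|x0] //; split.
  by rewrite /dd take0; exact: dd_invariant_init.
rewrite (dd_coneS A (Ordinal km)) (ddS A (Ordinal km)).
by apply: dd_invariant_step; [exact: dd_cone_is_cone|exact/IH/ltnW].
Qed.

End DDInvariant.

Theorem proposition6 (R : realType) (m n : nat) (A : 'M[R]_(m, n.+1))
    (k : nat) (hk : (k <= m)%N) (F : set 'cV[R]_n.+1) (x : 'cV[R]_n.+1)
    (j : nat) (hF : is_face F (dd_cone A k)) (hx : relint F x)
    (hj : (j < size (dd_R (dd A k)))%N)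
    (hRj : F (nth 0 (dd_R (dd A k)) j)) :
  0 < nth (fun=> 0) (dd_mu (dd A k)) j x.
Proof.
have [FK _ _] := hF.
have [e e0 Fe] := relint_extend hx hRj.
have [KD KZ] := dd_cone_is_cone A k.
have inv := dd_invariant_dd A hk; have sR := size_rays inv.
set r := nth 0 _ j in hRj Fe; set mu := nth _ _ j.
have jrays : (r, mu) \in rays (dd A k).
  by rewrite /rays (zip_nth_iota 0 (fun=> 0) sR) map_f // mem_iota.
(* Rescaling (1 + e) x - e r by the inverse of 1 + e. *)
have e1 : 0 < 1 + e by rewrite addr_gt0.
apply: (mu_gt0 inv (e := e / (1 + e)) jrays (FK _ (proj1 hx))).
  exact: divr_gt0.
have -> : x - (e / (1 + e)) *: r = (1 + e)^-1 *: (x + e *: (x - r)).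
  apply/colP => i; rewrite !mxE; field.
  exact: lt0r_neq0.
by apply: KZ; [rewrite invr_ge0 ltW|exact: FK].
Qed.
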